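(* For every integer $n\geq 1$, the two polynomials $A_n^+(s,t)$ and $A_n^-(s,t)$ are both gamma positive if and only if $n\equiv 0$ or $1 \pmod 4$. Further, both polynomials have the same center of symmetry.
   Context: For a permutation $\pi=\pi_1\pi_2\cdots\pi_n$ of $[n]=\{1,\dots,n\}$ let $\mathsf{des}(\pi)=|\{i\in[n-1]:\pi_i>\pi_{i+1}\}|$ and $\mathsf{asc}(\pi)=n-1-\mathsf{des}(\pi)$. Let $\mathfrak{S}_n$ be the symmetric group and $\mathcal{A}_n\subseteq\mathfrak{S}_n$ the alternating group (permutations with an even number of inversions). Define $A_n^+(s,t)=\sum_{\pi\in\mathcal{A}_n}t^{\mathsf{des}(\pi)}s^{\mathsf{asc}(\pi)}$ and $A_n^-(s,t)=\sum_{\pi\in\mathfrak{S}_n\setminus\mathcal{A}_n}t^{\mathsf{des}(\pi)}s^{\mathsf{asc}(\pi)}$; these are homogeneous of degree $n-1$. A homogeneous polynomial $f(s,t)$ of degree $d$ is called (bivariate) gamma positive if it can be written as $f(s,t)=\sum_{i=0}^{\lfloor d/2\rfloor}\gamma_i (st)^i(s+t)^{d-2i}$ with all $\gamma_i\geq 0$. The center of symmetry of a nonzero polynomial in $t$ (or homogeneous polynomial in $s,t$), whose nonzero terms have exponents of $t$ ranging from smallest $r$ to largest $N$, is $(N+r)/2$.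
   Formalization: The claim about the same center of symmetry is stated only for n ≡ 0 or 1 (mod 4) with n > 1: for n ≡ 2, 3 (mod 4) the centers differ (A_2^+ = s, A_2^- = t), and A_1^- = 0 has no center. *)

(* Defs.v *)
From mathcomp Require Import all_boot all_order all_algebra all_fingroup.
From mathcomp Require Import alt.
From mathcomp Require Import mpoly.

Set Implicit Arguments.
Unset Strict Implicit.
Unset Printing Implicit Defensive.

Import Order.TTheory GRing.Theory Num.Theory.
Local Open Scope group_scope.
Local Open Scope ring_scope.

(* Positions and values are 0-based: p : 'S_n is the word p 0, ..., p (n-1).  *)
Definition inv n (p : 'S_n) : nat :=
  #|[set ij : 'I_n * 'I_n | (ij.1 < ij.2)%N & (p ij.2 < p ij.1)%N]|.

Definition des n (p : 'S_n) : nat :=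
  #|[set i : 'I_n |
      [exists j : 'I_n, (j == i.+1 :> nat) && (p j < p i)%N]]|.

Definition asc n (p : 'S_n) : nat := (n - 1 - des p)%N.

Definition altset n : {set 'S_n} := [set p | ~~ odd (inv p)].

Lemma odd_inv n (p : 'S_n) : odd (inv p) = odd_perm p.
Proof.
pose a : 'rV[int]_n := \row_i (i : nat)%:Z.
have Vp : Vandermonde n (\row_i a 0 (p i)) = col_perm p (Vandermonde n a).
  by apply/matrixP=> i j; rewrite !mxE.
have dV : \det (Vandermonde n (\row_i a 0 (p i)))
          = \det (Vandermonde n a) * (-1) ^+ p.
  by rewrite Vp col_permE det_mulmx det_perm odd_permV.
have pos : 0 < \det (Vandermonde n a).
  rewrite det_Vandermonde; apply: prodr_gt0 => i _; apply: prodr_gt0 => j ij.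
  by rewrite !mxE subr_gt0 ltz_nat.
have sgV : Num.sg (\det (Vandermonde n (\row_i a 0 (p i)))) = (-1) ^+ inv p.
  rewrite det_Vandermonde pair_big_dep /=.
  rewrite (big_morph (@Num.sg int) (@sgrM _) (@sgr1 _)).
  rewrite (eq_bigr (fun ij : 'I_n * 'I_n => (-1) ^+ (p ij.2 < p ij.1)%N)).
    rewrite prodrXr; congr (_ ^+ _).
    rewrite /inv -sum1dep_card big_mkcond [RHS]big_mkcond /=.
    by apply: eq_bigr => ij _; case: (_ < _)%N; case: (_ < _)%N.
  move=> [i j] /= ij; rewrite !mxE; case: ltnP => pij.
    by rewrite ltr0_sg // subr_lt0 ltz_nat.
  rewrite gtr0_sg // subr_gt0 ltz_nat ltn_neqAle pij andbT.
  by apply: contraTneq ij => /val_inj/perm_inj ->; rewrite ltnn.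
move: sgV; rewrite dV sgrM (gtr0_sg pos) mul1r sgrX sgrN1 => /eqP.
by rewrite -[_ ^+ inv p]signr_odd => /eqP/signr_inj.
Qed.

Lemma altsetE n : altset n = 'Alt_'I_n :> {set 'S_n}.
Proof. by apply/setP=> p; rewrite inE odd_inv Alt_even. Qed.

(* In {mpoly R[2]} the variable s is 'X_0 and t is 'X_1. *)
Definition sidx : 'I_2 := inord 0.
Definition tidx : 'I_2 := inord 1.

Section Bivariate.
Variable R : realDomainType.
Implicit Types f : {mpoly R[2]}.

Local Notation s := ('X_sidx : {mpoly R[2]}).
Local Notation t := ('X_tidx : {mpoly R[2]}).

Definition Aplus n : {mpoly R[2]} :=
  \sum_(p in altset n) t ^+ des p * s ^+ asc p.

Definition Aminus n : {mpoly R[2]} :=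
  \sum_(p in ~: altset n) t ^+ des p * s ^+ asc p.

(* The degree d is a parameter because the zero polynomial is homogeneous of
   every degree. *)
Definition gamma_positive (d : nat) f : Prop :=
  f \is d.-homog /\
  exists g : nat -> R,
    (forall i, (i <= d./2)%N -> 0 <= g i) /\
    f = \sum_(i < d./2.+1) g i *: ((s * t) ^+ i * (s + t) ^+ (d - i.*2)).

(* Never holds for f = 0: the centre is only defined for nonzero f. *)
Definition center_of_symmetry f (c : rat) : Prop :=
  exists r N : nat,
    [/\ exists2 m, m \in msupp f & m tidx = r,
        exists2 m, m \in msupp f & m tidx = N,
        forall m, m \in msupp f -> (r <= m tidx <= N)%N
      & c = (N + r)%:R / 2].

End Bivariate.

(* Main.v *)
Require Import Defs.
From mathcomp Require Import all_boot all_order all_algebra all_fingroup.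
From mathcomp Require Import mpoly.
From mathcomp Require Import zify ring lra.

(* Let A_n = A_n^+ + A_n^- and B_n = A_n^+ - A_n^-. Sorting permutations by
   their last letter and deleting it gives one recurrence for both, with a
   parameter q equal to 1 or -1 that records the sign. For q = -1 the
   contributions of the last letters 2a and 2a+1 nearly cancel, and what is left
   obeys the unsigned recurrence at half the size, whence
   B_n = (s - t)^(floor (n/2)) A_(ceil (n/2)) (Desarmenien-Foata).
   For q = 1 it yields A_(n+1) = (s + t) A_n + s t (d/ds + d/dt) A_n, hence
   nonnegative gamma coefficients for A_n.

   If floor (n/2) is odd, A_n^+ takes the values 1 and 0 at (s,t) = (1,0) and
   (0,1), so it is not symmetric. If floor (n/2) = 2k, then
   (s - t)^2 = (s + t)^2 - 4 s t shows that the gamma polynomial of B_n is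
   (1 - 4x)^k times that of A_(ceil (n/2)). Its coefficients are bounded in
   absolute value by those of A_n, because multiplication by 1 + 4x is dominated
   by two steps of the recurrence for the gamma coefficients; the two gamma
   vectors also agree modulo 2. *)

Set Implicit Arguments.
Unset Strict Implicit.
Unset Printing Implicit Defensive.

Import Order.TTheory GRing.Theory Num.Theory.
Local Open Scope ring_scope.

(** * Descents under insertion and deletion of the last letter *)

Lemma des_sum n (p : 'S_n.+1) : des p =
  (\sum_(i < n) (p (lift ord0 i) < p (widen_ord (leqnSn n) i))%N)%N.
Proof.
rewrite /des -sum1dep_card big_mkcond big_ord_recr /=.
rewrite [X in (_ + X)%N](_ : _ = 0%N) ?addn0; last first.
  case: existsP => // -[j /andP[/eqP jn _]].
  by have := ltn_ord j; rewrite jn /= ltnn.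
apply: eq_bigr => i _; case: existsP => [[j /andP[/eqP ji pji]]|nex].
  have -> : lift ord0 i = j by apply: val_inj; rewrite /= ji.
  by rewrite pji.
by case: ltnP => // pi; case: nex; exists (lift ord0 i); rewrite pi andbT.
Qed.

Lemma des_leq n (p : 'S_n.+1) : (des p <= n)%N.
Proof.
rewrite des_sum -[X in (_ <= X)%N]card_ord -sum1_card.
by apply: leq_sum => i _; apply: leq_b1.
Qed.

(** Appending the letter j raises the old letters that are at least j by one. This keeps their
    relative order, so only the new final position can add a descent. *)
Lemma des_lift_perm n (j : 'I_n.+2) (p : 'S_n.+1) :
  des (lift_perm ord_max j p) = (des p + (j <= p ord_max))%N.
Proof.
have ltn_lift (k l : 'I_n.+1) : (lift j k < lift j l)%N = (k < l)%N.
  by rewrite /= /bump; lia.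
rewrite !des_sum big_ord_recr /=; congr (_ + _)%N.
  apply: eq_bigr => i _.
  have -> : lift ord0 (widen_ord (leqnSn n) i) = lift ord_max (lift ord0 i).
    by apply: val_inj; have := ltn_ord i; rewrite /= /bump; lia.
  have -> : widen_ord (leqnSn n.+1) (widen_ord (leqnSn n) i) =
            lift ord_max (widen_ord (leqnSn n) i).
    by apply: val_inj; have := ltn_ord i; rewrite /= /bump; lia.
  by rewrite !lift_perm_lift ltn_lift.
have -> : lift ord0 ord_max = ord_max :> 'I_n.+2 by apply: val_inj.
have -> : widen_ord (leqnSn n.+1) ord_max = lift ord_max ord_max.
  by apply: val_inj; rewrite /= /bump; lia.
by rewrite lift_perm_id lift_perm_lift /= /bump; lia.
Qed.

(** The inverse deletes position i and closes the gap that the value j leaves, by [unlift]. *)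
Lemma lift_perm_bij n (i j : 'I_n.+1) :
  {on [pred p : 'S_n.+1 | p i == j], bijective (lift_perm i j)}.
Proof.
pose f (p : 'S_n.+1) (k : 'I_n) : 'I_n := odflt k (unlift (p i) (p (lift i k))).
have fE (p : 'S_n.+1) k : lift (p i) (f p k) = p (lift i k).
  rewrite /f; case: unliftP => [l -> //|/perm_inj /esym/eqP].
  by rewrite (negPf (neq_lift i k)).
have f_inj (p : 'S_n.+1) : injective (f p).
  move=> k l fkl; have := fE p k; rewrite fkl fE => /perm_inj.
  by move/lift_inj.
exists (fun p => perm (f_inj p)) => [p _|p /eqP pij]; apply/permP=> k.
  apply: (@lift_inj _ j).
  by rewrite permE -{1}(lift_perm_id i j p) fE lift_perm_lift.
case: (unliftP i k) => [l|] ->; last by rewrite lift_perm_id pij.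
by rewrite lift_perm_lift permE -pij fE.
Qed.

(** * Gamma coefficients: vanishing, growth and parity *)

Definition shift_coef (f : nat -> int) i : int := if i is j.+1 then f j else 0.

(* The index d is the degree, so this is the gamma vector of A_(d+1). *)
Fixpoint eulerian_gamma d i : int :=
  if d is e.+1 then
    i.+1%:Z * eulerian_gamma e i
    + 2 * (d.+1%:Z - i.*2%:Z) * shift_coef (eulerian_gamma e) i
  else (i == 0)%:Z.
Arguments eulerian_gamma : simpl never.

Lemma eulerian_gammaS d i : eulerian_gamma d.+1 i =
  i.+1%:Z * eulerian_gamma d i
  + 2 * (d.+2%:Z - i.*2%:Z) * shift_coef (eulerian_gamma d) i.
Proof. by []. Qed.

Lemma eulerian_gamma_gt d i : (d < i.*2)%N -> eulerian_gamma d i = 0.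
Proof.
elim: d i => [|d IH] [|i] // di; rewrite eulerian_gammaS.
rewrite IH; last lia.
rewrite mulr0 add0r /=.
(* In the borderline case 2i = d the factor d + 2 - 2(i + 1) vanishes. *)
have [di2|ne] := eqVneq i.*2 d; last by rewrite IH ?mulr0 //; lia.
by rewrite [X in _ * X * _](_ : _ = 0) ?mulr0 ?mul0r //; lia.
Qed.

Lemma eulerian_gamma_ge0 d i : 0 <= eulerian_gamma d i.
Proof.
elim: d i => [|d IH] i //; rewrite eulerian_gammaS.
have := IH i; case: i => [|i] /= IHi; first by rewrite mulr0; lia.
have := IH i; have [di|di] := leqP i.*2 d; last first.
  by rewrite (eulerian_gamma_gt di) mulr0; nia.
by nia.
Qed.

Lemma eulerian_gamma0 d : eulerian_gamma d 0 = 1.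
Proof. by elim: d => // d IH; rewrite eulerian_gammaS IH mulr0 addr0. Qed.

(** Two steps of the recurrence write the right side in three consecutive coefficients at level d,
    and these are compared one by one. For d = 0 the bound fails: there 1 + 4x would have to be
    dominated by 1 + 2x. *)
Lemma eulerian_gamma_dominates d i : (0 < d)%N ->
  eulerian_gamma d i + 4 * shift_coef (eulerian_gamma d) i
    <= eulerian_gamma d.+2 i.
Proof.
move=> d0; rewrite eulerian_gammaS [eulerian_gamma d.+1 i]eulerian_gammaS.
case: i => [|i]; first by rewrite /= !eulerian_gamma0.
rewrite /= [eulerian_gamma d.+1 i]eulerian_gammaS.
have h1 := eulerian_gamma_ge0 d i.+1; have h2 := eulerian_gamma_ge0 d i.
have h3 : 0 <= (d.+3%:Z - i.+1.*2%:Z)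
    * ((d.+2%:Z - i.*2%:Z) * shift_coef (eulerian_gamma d) i).
  case: i {h1 h2} => [|i]; first by rewrite !mulr0.
  have h := eulerian_gamma_ge0 d i; have [di|di] := leqP i.*2 d; last first.
    by rewrite /= (eulerian_gamma_gt di) !mulr0.
  (* For d = 2i the outer factor is -1, but the inner one is 0. *)
  have [->|/eqP ne] := eqVneq d i.*2.
    rewrite /= [X in _ * (X * _)](_ : _ = 0) ?mul0r ?mulr0 //; lia.
  rewrite !mulr_ge0 //=; lia.
have [di|di] := leqP i.*2 d; last first.
  rewrite (eulerian_gamma_gt di) !mulr0 addr0 addr0.
  nia.
(* The coefficient of [eulerian_gamma d i] is twice this bracket and must reach 4. The tight case is
   d = 2i, where the bracket is i + 1 and d > 0 gives i >= 1. *)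
have h4 : 0 <= ((i.+2%:Z * (d.+2%:Z - i.+1.*2%:Z)
    + (d.+3%:Z - i.+1.*2%:Z) * i.+1%:Z) - 2) * eulerian_gamma d i.
  apply: mulr_ge0 => //; nia.
have h5 : 0 <= (i.+2%:Z * i.+2%:Z - 1) * eulerian_gamma d i.+1.
  by apply: mulr_ge0 => //; nia.
move: h3 h4 h5; set x := eulerian_gamma d i; set y := eulerian_gamma d i.+1.
set z := shift_coef _ _.
move: (i.+2%:Z) (i.+1%:Z) (i.*2%:Z) (i.+1.*2%:Z) (d.+2%:Z) (d.+3%:Z) => *.
lra.
Qed.

(* On generating polynomials, multiplication by 1 - 4x. *)
Definition mul_1sub4x (f : nat -> int) i : int := f i - 4 * shift_coef f i.

(** By the triangle inequality a factor 1 - 4x costs at most a factor 1 + 4x in the bound, which two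
    steps of the recurrence absorb. *)
Lemma mul_1sub4x_iter_bound d k i : (0 < d)%N || (k == 0)%N ->
  `|iter k mul_1sub4x (eulerian_gamma d) i| <= eulerian_gamma (d + k.*2) i.
Proof.
elim: k i => [|k IH] i; first by rewrite addn0 ger0_norm ?eulerian_gamma_ge0.
rewrite orbF => d0; rewrite iterS doubleS !addnS.
apply: le_trans (eulerian_gamma_dominates i _); last by lia.
have := IH i; rewrite d0 => /(_ isT).
have h : `|shift_coef (iter k mul_1sub4x (eulerian_gamma d)) i|
    <= shift_coef (eulerian_gamma (d + k.*2)) i.
  by case: i => //= i; apply: IH; rewrite d0.
move: h; rewrite /mul_1sub4x; set x := shift_coef _ _.
set y := shift_coef _ _; lia.
Qed.

Lemma mul_1sub4x_iter0 d k : iter k mul_1sub4x (eulerian_gamma d) 0 = 1.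
Proof.
by elim: k => [|k IH]; [exact: eulerian_gamma0 | rewrite iterS /mul_1sub4x IH].
Qed.

Lemma eulerian_gamma_even d i : exists x : int,
  eulerian_gamma d i.+1 = 2 * x.
Proof.
elim: d i => [|d IH] i; first by exists 0.
have [x ex] := IH i; rewrite eulerian_gammaS ex /=.
exists (i.+2%:Z * x + (d.+2%:Z - i.+1.*2%:Z) * eulerian_gamma d i); ring.
Qed.

Lemma mul_1sub4x_iter_even d k i : exists x : int,
  iter k mul_1sub4x (eulerian_gamma d) i.+1 = 2 * x.
Proof.
elim: k i => [|k IH] i; first exact: eulerian_gamma_even.
have [x ex] := IH i; rewrite iterS /mul_1sub4x ex.
exists (x - 2 * iter k mul_1sub4x (eulerian_gamma d) i); rewrite /=; ring.
Qed.

(** * Weights by last letter, and the factorization of the signed sum *)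

Section Weights.
Variables (K : comNzRingType) (s t : K).

(* The words have length n + 1 and last letter j; only j <= n is meaningful. *)
Fixpoint last_weight (q : K) n j : K :=
  if n is m.+1 then
    q ^+ (n + j) * (s * \sum_(0 <= i < j) last_weight q m i
                    + t * \sum_(j <= i < n) last_weight q m i)
  else 1.
Arguments last_weight : simpl never.

Definition total_weight q n : K := \sum_(0 <= j < n.+1) last_weight q n j.

Lemma last_weightS q n j : last_weight q n.+1 j =
  q ^+ (n.+1 + j) * (s * \sum_(0 <= i < j) last_weight q n i
                     + t * \sum_(j <= i < n.+1) last_weight q n i).
Proof. by []. Qed.

Lemma sum_pairs (f : nat -> K) a c : (a <= c)%N ->
  \sum_(a.*2 <= i < c.*2) f i = \sum_(a <= b < c) (f b.*2 + f b.*2.+1).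
Proof.
move=> /subnK <-; elim: (c - a)%N => [|k IH]; first by rewrite add0n !big_geq.
rewrite addSn doubleS big_nat_recr /=; last lia.
rewrite big_nat_recr /=; last lia.
by rewrite IH [in RHS]big_nat_recr /= ?addrA //; lia.
Qed.

Local Notation U := (last_weight 1).
Local Notation E := (last_weight (-1)).

(** The last letters 2a and 2a+1 carry opposite signs, and their sums differ only in the treatment
    of the previous letter 2a: factor t in one, s in the other. What survives is, up to sign, (s -
    t) times [E n.+1 a.*2], which is then unfolded once more. *)
Lemma signed_pair_step n a : (a.*2 <= n.+1)%N ->
  E n.+2 a.*2 + E n.+2 a.*2.+1 =
  (s - t) * (s * \sum_(0 <= i < a.*2) E n i
             + t * \sum_(a.*2 <= i < n.+1) E n i).
Proof.
move=> an; rewrite last_weightS [E n.+2 a.*2.+1]last_weightS.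
rewrite [\sum_(0 <= i < a.*2.+1) _]big_nat_recr //=.
rewrite [\sum_(a.*2 <= i < n.+2) _]big_ltn //=.
rewrite [E n.+1 a.*2]last_weightS.
rewrite addnS exprS mulN1r -signr_odd -[(-1) ^+ (n.+1 + _)]signr_odd.
rewrite !oddD !odd_double /= !addbF negbK.
move: (\sum_(0 <= i < a.*2) _ : K) (\sum_(a.*2.+1 <= i < n.+2) _ : K)
  (\sum_(0 <= i < a.*2) _ : K) (\sum_(a.*2 <= i < n.+1) _ : K) => w x y z.
by case: (odd n) => /=; rewrite ?expr0 ?expr1; ring.
Qed.

(** The pair 2a, 2a+1 acts as the single letter a in a word of half the length; every two letters
    removed cost one factor s - t. *)
Lemma signed_pairs_odd m a : (a <= m)%N ->
  E m.*2.+1 a.*2 + E m.*2.+1 a.*2.+1 = (s - t) ^+ m.+1 * U m a.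
Proof.
elim: m a => [|m IH] a.
  rewrite leqn0 => /eqP ->; rewrite !last_weightS /= !big_nat1 !big_geq //.
  by rewrite -signr_odd -[(-1) ^+ (1 + 1)]signr_odd /= ; ring.
move=> am; rewrite doubleS signed_pair_step; last lia.
rewrite -[m.*2.+2]doubleS !sum_pairs // -[X in \sum_(X <= i < _) _]double0.
rewrite sum_pairs // last_weightS expr1n mul1r exprS -mulrA; congr (_ * _).
rewrite mulrDr !(mulrCA (_ ^+ _)) !mulr_sumr; congr (_ + _).
  by apply: eq_big_nat => b /andP[_ ba]; rewrite IH //; lia.
by apply: eq_big_nat => b /andP[_ ba]; rewrite IH //; lia.
Qed.

Lemma total_weight_signed_odd m :
  total_weight (-1) m.*2.+1 = (s - t) ^+ m.+1 * total_weight 1 m.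
Proof.
rewrite /total_weight -doubleS -[X in \sum_(X <= i < _) _]double0 sum_pairs //.
rewrite mulr_sumr; apply: eq_big_nat => b /andP[_ ba].
by rewrite signed_pairs_odd.
Qed.

Lemma last_weight_max q n : last_weight q n.+1 n.+1 =
  q ^+ (n.+1).*2 * (s * total_weight q n).
Proof. by rewrite last_weightS addnn [X in t * X]big_geq // mulr0 addr0. Qed.

(** Here the top letter 2m has no partner. Its weight is obtained from the total of the preceding
    odd case, so both claims go through one induction. *)
Lemma signed_pairs_even m :
  E m.*2 m.*2 = (s - t) ^+ m * U m m /\
  (forall a, (a < m)%N ->
     E m.*2 a.*2 + E m.*2 a.*2.+1 = (s - t) ^+ m * U m a).
Proof.
elim: m => [|m [IH1 IH2]]; first by rewrite expr0 mul1r.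
split=> [|a am].
  rewrite doubleS !last_weight_max total_weight_signed_odd expr1n mul1r.
  by rewrite -signr_odd odd_double expr0 mul1r mulrCA.
rewrite doubleS signed_pair_step; last lia.
rewrite big_nat_recr /=; last lia.
rewrite IH1 -[X in \sum_(X <= i < _) _]double0 !sum_pairs //.
rewrite last_weightS expr1n mul1r [in RHS]big_nat_recr //.
rewrite exprS -mulrA; congr (_ * _).
rewrite !mulrDr !(mulrCA (_ ^+ _)) !mulr_sumr; congr (_ + (_ + _)).
  by apply: eq_big_nat => b /andP[_ ba]; rewrite IH2 //; lia.
by apply: eq_big_nat => b /andP[_ ba]; rewrite IH2 //; lia.
Qed.

Lemma total_weight_signed_even m :
  total_weight (-1) m.*2 = (s - t) ^+ m * total_weight 1 m.
Proof.
have [top pairs] := signed_pairs_even m.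
rewrite /total_weight !big_nat_recr //= top mulrDr; congr (_ + _).
rewrite -[X in \sum_(X <= i < _) _]double0 sum_pairs //.
by rewrite mulr_sumr; apply: eq_big_nat => b /andP[_ ba]; rewrite pairs.
Qed.

(** * Polynomials given by their gamma coefficients *)

Definition gamma_term d i : K := (s * t) ^+ i * (s + t) ^+ (d - i.*2).

Definition gamma_sum d (f : nat -> int) : K :=
  \sum_(i < d./2.+1) gamma_term d i *~ f i.

Definition gamma_support d (f : nat -> int) :=
  forall i, (d < i.*2)%N -> f i = 0.

(** Sums for different degrees have different lengths; this brings them to a common range. *)
Lemma gamma_sum_widen N d f : gamma_support d f -> (d./2 < N)%N ->
  gamma_sum d f = \sum_(i < N) gamma_term d i *~ f i.
Proof.
move=> supp dN; rewrite /gamma_sum.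
rewrite (big_ord_widen N (fun i => gamma_term d i *~ f i)) //.
rewrite big_mkcond; apply: eq_bigr => i _; case: ltnP => // id.
by rewrite supp ?mulr0z //; lia.
Qed.

Lemma sum_shift N (F : nat -> K) (f : nat -> int) :
  \sum_(i < N.+1) F i *~ shift_coef f i = \sum_(i < N) F i.+1 *~ f i.
Proof. by rewrite big_ord_recl /= mulr0z add0r. Qed.

Lemma gamma_support_mul_1sub4x d f :
  gamma_support d f -> gamma_support d.+2 (mul_1sub4x f).
Proof.
move=> supp [|i] // di; rewrite /mul_1sub4x /= !supp ?mulr0 ?subr0 //; lia.
Qed.

Lemma gamma_sum_mul_1sub4x d f : gamma_support d f ->
  gamma_sum d.+2 (mul_1sub4x f) = (s - t) ^+ 2 * gamma_sum d f.
Proof.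
move=> supp; rewrite (gamma_sum_widen (N := d.+2)); last 2 first.
- exact: gamma_support_mul_1sub4x.
- lia.
rewrite (gamma_sum_widen (N := d.+1) supp); last lia.
have -> : \sum_(i < d.+2) gamma_term d.+2 i *~ mul_1sub4x f i =
    \sum_(i < d.+2) gamma_term d.+2 i *~ f i
    - 4 * \sum_(i < d.+2) gamma_term d.+2 i *~ shift_coef f i.
  rewrite mulr_sumr -sumrB; apply: eq_bigr => i _.
  by rewrite mulrzBr; congr (_ - _); rewrite [in LHS]mulrC mulrzA mulr_natl.
rewrite sum_shift big_ord_recr /= supp ?mulr0z ?addr0; last lia.
rewrite !mulr_sumr -sumrB; apply: eq_bigr => i _.
(* Beyond the support the truncated exponent [d - i.*2] would spoil the termwise identity, but there
   the coefficient is 0. *)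
have [id|di] := leqP i.*2 d; last by rewrite supp ?mulr0z ?mulr0 ?subr0.
rewrite /gamma_term !mulrzAr -mulrzBl; congr (_ *~ _).
rewrite doubleS subSS subSS subSn ?subSn //; last lia.
by rewrite !exprS; ring.
Qed.

Lemma gamma_sum_mul_1sub4x_iter k d f : gamma_support d f ->
  gamma_support (d + k.*2) (iter k mul_1sub4x f) /\
  gamma_sum (d + k.*2) (iter k mul_1sub4x f) = (s - t) ^+ k.*2 * gamma_sum d f.
Proof.
move=> supp; elim: k => [|k [IH1 IH2]]; first by rewrite addn0 mul1r.
rewrite doubleS !addnS iterS; split; first exact: gamma_support_mul_1sub4x.
by rewrite gamma_sum_mul_1sub4x // IH2 mulrA -exprD.
Qed.

(** * The unsigned recurrence through a derivation [D], later d/ds + d/dt *)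

Section Derivation.
Variable D : {additive K -> K}.
Hypothesis DM : forall x y, D (x * y) = D x * y + x * D y.
Hypotheses (Ds : D s = 1) (Dt : D t = 1).

Lemma derivation1 : D 1 = 0.
Proof.
have /eqP := DM 1 1; rewrite !mul1r mulr1.
by rewrite -subr_eq0 opprD addrA subrr sub0r oppr_eq0 => /eqP.
Qed.

Lemma derivationX x n : D (x ^+ n) = (x ^+ n.-1 * D x) *+ n.
Proof.
elim: n => [|n IH]; first by rewrite derivation1 mulr0n.
rewrite exprS DM IH mulrS mulrC; congr (_ + _).
case: n {IH} => [|n]; first by rewrite !mulr0n mulr0.
by rewrite mulrnAr mulrA -exprS.
Qed.

(* In terms of words this is the insertion of a new maximal letter anywhere
   but at the end. *)
Lemma last_weight_insert_max n j : (j <= n)%N ->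
  U n.+1 j = t * U n j + s * t * D (U n j).
Proof.
elim: n j => [|n IH] j jn.
  move: jn; rewrite leqn0 => /eqP ->.
  by rewrite last_weightS big_geq // big_nat1 /= expr1n derivation1; ring.
rewrite last_weightS expr1n mul1r [\sum_(j <= i < n.+2) _]big_nat_recr //=.
rewrite last_weight_max expr1n mul1r.
(* The terms of the product rule in which [D] hits s or t add up to s t times the total weight, the
   contribution of the previous letter n + 1. *)
rewrite [U n.+1 j]last_weightS expr1n mul1r raddfD !DM Ds Dt /total_weight.
rewrite [\sum_(0 <= i < n.+1) _](big_cat_nat (n := j)) //=.
have sumU m p : (p <= n.+1)%N -> \sum_(m <= i < p) U n.+1 i =
    t * \sum_(m <= i < p) U n i + s * t * D (\sum_(m <= i < p) U n i).
  move=> pn; rewrite raddf_sum !mulr_sumr -big_split /=.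
  by apply: eq_big_nat => i /andP[_ ip]; rewrite IH //; lia.
rewrite !sumU //; ring.
Qed.

Lemma total_weight_rec n : total_weight 1 n.+1 =
  (s + t) * total_weight 1 n + s * t * D (total_weight 1 n).
Proof.
rewrite {1}/total_weight big_nat_recr //=.
rewrite last_weight_max expr1n mul1r mulrDl -addrA [LHS]addrC; congr (_ + _).
rewrite /total_weight raddf_sum !mulr_sumr -big_split /=.
by apply: eq_big_nat => j /andP[_ jn]; rewrite -last_weight_insert_max.
Qed.
(** Since [D] sends s t to s + t and s + t to 2, a basis term yields just two basis terms of the
    next degree. This is the source of the recurrence defining [eulerian_gamma]. *)
Lemma gamma_term_step d i : (i.*2 <= d)%N ->
  (s + t) * gamma_term d i + s * t * D (gamma_term d i) =
  gamma_term d.+1 i *+ i.+1 + gamma_term d.+1 i.+1 *+ (2 * (d - i.*2)).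
Proof.
move=> di; rewrite /gamma_term DM !derivationX DM raddfD /= Ds Dt.
rewrite subSn // doubleS !subSS; set e := (d - i.*2)%N.
(* At i = 0 the truncated exponent [i.-1] is harmless because of the factor i. *)
have stX : i%:R * (s * t * (s * t) ^+ i.-1) = i%:R * (s * t) ^+ i.
  by case: i {di e} => [|i]; rewrite ?mul0r // -exprS.
have -> : (d - i.*2.+1 = e.-1)%N by rewrite subnS.
rewrite exprS [(s * t) ^+ i.+1]exprS -(mulr_natl _ i).
rewrite -(mulr_natl _ e) -(mulr_natl _ i.+1) -(mulr_natl _ (2 * e)).
rewrite natrM -natr1.
move: stX.
move: (e%:R : K) (i%:R : K) ((s * t) ^+ i) ((s * t) ^+ i.-1) => y x P P'.
move: ((s + t) ^+ e) ((s + t) ^+ e.-1) => Q Q' stX.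
rewrite [LHS](_ : _ = (s + t) * P * Q + x * (s * t * P') * (s + t) * Q
  + 2 * y * (s * t) * P * Q'); last by ring.
by rewrite stX; ring.
Qed.

Lemma gamma_sum_eulerian_rec d :
  gamma_sum d.+1 (eulerian_gamma d.+1) =
  (s + t) * gamma_sum d (eulerian_gamma d)
  + s * t * D (gamma_sum d (eulerian_gamma d)).
Proof.
rewrite (gamma_sum_widen (N := d.+2) (@eulerian_gamma_gt d.+1)); last lia.
rewrite (gamma_sum_widen (N := d.+1) (@eulerian_gamma_gt d)); last lia.
rewrite raddf_sum !mulr_sumr -big_split /=.
have -> : \sum_(i < d.+2) gamma_term d.+1 i *~ eulerian_gamma d.+1 i =
    \sum_(i < d.+2) gamma_term d.+1 i *~ i.+1%:Z *~ eulerian_gamma d i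
    + \sum_(i < d.+2) gamma_term d.+1 i *~ (2 * (d.+2%:Z - i.*2%:Z))
       *~ shift_coef (eulerian_gamma d) i.
  rewrite -big_split; apply: eq_bigr => i _.
  by rewrite eulerian_gammaS mulrzDr !mulrzA.
rewrite (sum_shift _ (fun i => gamma_term d.+1 i *~ (2 * (d.+2%:Z - i.*2%:Z)))).
rewrite big_ord_recr /= eulerian_gamma_gt ?mulr0z ?addr0; last lia.
rewrite -big_split; apply: eq_bigr => i _ /=.
have [di|di] := leqP i.*2 d; last first.
  by rewrite eulerian_gamma_gt // !mulr0z raddf0 !mulr0 addr0.
rewrite raddfMz !mulrzAr -!mulrzDl gamma_term_step //; congr (_ *~ _).
congr (_ + _); rewrite [RHS]pmulrn; congr (_ *~ _); lia.
Qed.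

Lemma total_weight_gamma d :
  total_weight 1 d = gamma_sum d (eulerian_gamma d).
Proof.
elim: d => [|d IH]; last by rewrite total_weight_rec IH gamma_sum_eulerian_rec.
by rewrite /total_weight big_nat1 /gamma_sum big_ord1 /gamma_term !expr0 mulr1.
Qed.
End Derivation.
End Weights.

(** * Identification of the weights with sums over permutations *)

Section PermWeights.
Variables (K : comNzRingType) (s t q : K).
Hypothesis qq : q * q = 1.

Definition perm_weight n (p : 'S_n.+1) : K :=
  q ^+ odd_perm p * (t ^+ des p * s ^+ (n - des p)).

Lemma expr_odd_involutive k : q ^+ odd k = q ^+ k.
Proof.
rewrite -[in RHS](odd_double_half k) exprD -muln2 mulnC exprM expr2 qq expr1n.
by rewrite mulr1.
Qed.

(** A last letter j forms n + 1 - j new inversions, whence the power of q; as q is an involution,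
    only the parity matters. *)
Lemma perm_weight_lift n (j : 'I_n.+2) (p : 'S_n.+1) :
  perm_weight (lift_perm ord_max j p) =
  q ^+ (n.+1 + j) * ((if (p ord_max < j)%N then s else t) * perm_weight p).
Proof.
rewrite /perm_weight odd_lift_perm des_lift_perm -oddD.
have -> : q ^+ (odd (@ord_max n.+1 + j) (+) odd_perm p) =
          q ^+ (n.+1 + j) * q ^+ odd_perm p.
  by rewrite -[X in X * _]expr_odd_involutive; case: odd; case: odd_perm;
    rewrite /= ?expr0 ?expr1 ?mulr1 ?mul1r ?qq.
rewrite -mulrA; congr (_ * _).
have dn := des_leq p; case: ltnP => pj.
  rewrite addn0 (subSn dn) [s ^+ _.+1]exprS.
  by move: (q ^+ _) (t ^+ _) (s ^+ _) => x y z; ring.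
rewrite addn1 subSS [t ^+ _.+1]exprS.
by move: (q ^+ _) (t ^+ _) (s ^+ _) => x y z; ring.
Qed.

Lemma last_weight_perm n j : (j <= n)%N ->
  \sum_(p : 'S_n.+1 | p ord_max == j :> nat) perm_weight p =
  last_weight s t q n j.
Proof.
elim: n j => [|n IH] j jn.
  move: jn; rewrite leqn0 => /eqP ->.
  rewrite (big_pred1 1%g) => [|p]; last first.
    rewrite [p ord_max]ord1 eqxx; apply/esym/eqP/permP => i.
    by rewrite [LHS]ord1 [RHS]ord1.
  by rewrite /perm_weight des_sum big_ord0 odd_perm1 !expr0 !mulr1.
rewrite last_weightS.
have js : (j < n.+2)%N by [].
rewrite (reindex (lift_perm ord_max (Ordinal js))) /=; last first.
  have [g gK1 gK2] := lift_perm_bij ord_max (Ordinal js).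
  by exists g => p; rewrite inE => hp; [apply: gK1 | apply: gK2]; rewrite inE.
rewrite (eq_bigl predT) => [|p]; last by rewrite lift_perm_id eqxx.
under eq_bigr do rewrite perm_weight_lift.
rewrite -mulr_sumr; congr (_ * _).
(* Words with the last letter removed are grouped by their own last letter, so that the induction
   hypothesis applies to each group. *)
have part (P : pred nat) (c : K) :
    \sum_(p : 'S_n.+1 | P (p ord_max)) c * perm_weight p =
    c * \sum_(0 <= i < n.+1 | P i) last_weight s t q n i.
  rewrite -mulr_sumr; congr (_ * _); rewrite big_mkord.
  rewrite (partition_big (fun p : 'S_n.+1 => p ord_max)
                        (fun i : 'I_n.+1 => P i)) //=.
  apply: eq_bigr => i Pi; rewrite -IH -1?ltnS //; apply: eq_bigl => p.
  by rewrite -val_eqE /=; case: eqVneq => [->|_]; rewrite ?Pi ?andbF.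
rewrite (bigID (fun p : 'S_n.+1 => (p ord_max < j)%N)) /=; congr (_ + _).
  under eq_bigr => p -> do [].
  rewrite (part (fun i => (i < j)%N)); congr (_ * _).
  by rewrite (big_nat_widen 0 j n.+1).
under eq_bigr => p /negPf -> do [].
rewrite (part (fun i => ~~ (i < j)%N)); congr (_ * _).
rewrite [RHS](big_nat_widenl j 0) //; apply: eq_bigl => i; lia.
Qed.

Lemma total_weight_perm n :
  \sum_(p : 'S_n.+1) perm_weight p = total_weight s t q n.
Proof.
rewrite /total_weight big_mkord.
rewrite (partition_big (fun p : 'S_n.+1 => p ord_max) predT) //=.
by apply: eq_bigr => i _; rewrite -last_weight_perm -1?ltnS.
Qed.
End PermWeights.

(** * Symmetry and special values of gamma sums *)

Lemma gamma_sum_rmorph (K L : comNzRingType) (phi : {rmorphism K -> L})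
    s t d f :
  phi (gamma_sum s t d f) = gamma_sum (phi s) (phi t) d f.
Proof.
rewrite rmorph_sum; apply: eq_bigr => i _.
by rewrite rmorphMz /gamma_term rmorphM !rmorphXn rmorphM rmorphD.
Qed.

Lemma gamma_sum_swap (K : comNzRingType) (s t : K) d f :
  gamma_sum s t d f = gamma_sum t s d f.
Proof. by rewrite /gamma_sum /gamma_term mulrC addrC. Qed.

Lemma gamma_sum10 (K : comNzRingType) d f :
  gamma_sum (1 : K) 0 d f = (f 0)%:~R.
Proof.
rewrite /gamma_sum big_ord_recl big1 ?addr0 => [|i _].
  by rewrite /gamma_term addr0 expr0 expr1n mulr1.
by rewrite /gamma_term /= mulr0 expr0n mul0r mul0rz.
Qed.

Lemma gamma_sum11_gt0 (R : realDomainType) d f :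
  (forall i, 0 <= f i) -> f 0 = 1 -> 0 < gamma_sum (1 : R) 1 d f.
Proof.
move=> f_ge0 f0; have term_gt0 i : 0 < gamma_term (1 : R) 1 d i.
  by rewrite /gamma_term mulr1 expr1n mul1r exprn_gt0 ?addr_gt0.
rewrite /gamma_sum big_ord_recl f0; apply: ltr_wpDr; last exact: term_gt0.
by apply: sumr_ge0 => i _; rewrite mulrz_ge0 // ltW.
Qed.

Lemma tidxE : tidx = ord_max. Proof. by apply: val_inj; rewrite /= inordK. Qed.
Lemma sidxE : sidx = ord0. Proof. by apply: val_inj; rewrite /= inordK. Qed.

Lemma ord2P (i : 'I_2) : i = ord0 \/ i = ord_max.
Proof. by case: i => [[|[|//]] ?]; [left | right]; apply: val_inj. Qed.

(** * Gamma expansions of the even and odd parts *)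

Section Bivariate.
Variable R : realDomainType.
Local Notation s := ('X_sidx : {mpoly R[2]}).
Local Notation t := ('X_tidx : {mpoly R[2]}).

Lemma total_weight_mpoly d :
  total_weight s t 1 d = gamma_sum s t d (eulerian_gamma d).
Proof.
pose D : {additive {mpoly R[2]} -> {mpoly R[2]}} :=
  mderiv sidx \+ mderiv tidx.
have DX (i : 'I_2) : D 'X_i = 1.
  rewrite /D /= !mderivX !mnm1E sidxE tidxE.
  have subUU : (U_(i) - U_(i) = 0)%MM.
    by apply/mnmP => k; rewrite mnmBE mnm0E subnn.
  case: (ord2P i) subUU => -> subUU.
    by rewrite eqxx scale1r scale0r addr0 subUU mpolyX0.
  by rewrite eqxx scale1r scale0r add0r subUU mpolyX0.
apply: (@total_weight_gamma _ s t D) => // p q.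
by rewrite /D /= !mderivM; ring.
Qed.

Lemma Aplus_plus_Aminus n :
  Aplus R n.+1 + Aminus R n.+1 = total_weight s t 1 n.
Proof.
rewrite -total_weight_perm ?mulr1 // /Aplus /Aminus.
rewrite [RHS](bigID (mem (altset n.+1))) /=.
congr (_ + _).
  by apply: eq_bigr => p _; rewrite /perm_weight expr1n mul1r /asc subn1.
by apply: eq_big => p; rewrite ?inE // /perm_weight expr1n mul1r /asc subn1.
Qed.

Lemma Aplus_minus_Aminus n :
  Aplus R n.+1 - Aminus R n.+1 = total_weight s t (-1) n.
Proof.
rewrite -total_weight_perm ?mulrNN ?mulr1 // /Aplus /Aminus.
rewrite [RHS](bigID (mem (altset n.+1))) /=.
congr (_ + _); last rewrite -sumrN.
  apply: eq_bigr => p; rewrite inE odd_inv /perm_weight /asc subn1.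
  by move=> /negPf ->; rewrite mul1r.
apply: eq_big => p; rewrite ?inE // odd_inv negbK /perm_weight /asc subn1 => ->.
by rewrite mulN1r.
Qed.

Lemma des_asc_term_homog n (p : 'S_n.+1) : t ^+ des p * s ^+ asc p \is n.-homog.
Proof.
have : t ^+ des p * s ^+ asc p \is (1 * des p + 1 * asc p)%N.-homog.
  by apply: dhomogM; apply: dhomogMn; rewrite dhomogX /= mdeg1.
have -> // : (1 * des p + 1 * asc p = n)%N.
by rewrite /asc; have := des_leq p; lia.
Qed.

Lemma Aplus_homog n : Aplus R n.+1 \is n.-homog.
Proof. by apply: rpred_sum => p _; apply: des_asc_term_homog. Qed.

Lemma Aminus_homog n : Aminus R n.+1 \is n.-homog.
Proof. by apply: rpred_sum => p _; apply: des_asc_term_homog. Qed.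

Lemma gamma_positive_double d (f : {mpoly R[2]}) (h : nat -> int) :
  f \is d.-homog -> f *+ 2 = gamma_sum s t d h ->
  (forall i, 0 <= h i) -> (forall i, exists x, h i = 2 * x) ->
  gamma_positive d f.
Proof.
move=> fd f2 h_ge0 h_even; split=> //.
(* 2 need not be invertible in [R], so the halving takes place in the integers, where evenness makes
   it exact. *)
exists (fun i => ((h i %/ 2)%Z)%:~R); split=> [i _|].
  by rewrite ler0z; have [x hx] := h_even i; have := h_ge0 i; lia.
apply: (@mulIf _ 2%:R).
  by rewrite -[2%:R]/(1 *+ 2) -mpolyC1 -mpolyCMn mpolyC_eq0 pnatr_eq0.
rewrite mulr_natr f2 mulr_suml; apply: eq_bigr => i _.
rewrite scaler_int -/(gamma_term _ _ _ _) mulr_natr [RHS]pmulrn -mulrzA.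
by congr (_ *~ _); have [x hx] := h_even i; lia.
Qed.

(** For these d the exponent of s - t in the signed sum is even, so the factor acts on gamma
    coefficients as an iterate of [mul_1sub4x]. *)
Lemma signed_gamma d : d = 0 %[mod 4] \/ d = 3 %[mod 4] ->
  exists f : nat -> int, [/\ forall i, `|f i| <= eulerian_gamma d i,
    f 0 = 1, forall i, exists x, f i.+1 = 2 * x
    & total_weight s t (-1) d = gamma_sum s t d f].
Proof.
case=> d4.
  (* Half-size degree 2k and exponent 2k; if the degree is 0, then k = 0 and no factor occurs. *)
  pose k := (d %/ 4)%N; have -> : d = (k.*2 + k.*2)%N by lia.
  exists (iter k mul_1sub4x (eulerian_gamma k.*2)); split.
  - by move=> i; apply: mul_1sub4x_iter_bound; lia.
  - exact: mul_1sub4x_iter0.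
  - exact: mul_1sub4x_iter_even.
  rewrite {1}addnn total_weight_signed_even total_weight_mpoly.
  by have [_ ->] := gamma_sum_mul_1sub4x_iter s t k (@eulerian_gamma_gt k.*2).
(* Half-size degree 2k + 1 and exponent 2k + 2. *)
pose k := (d %/ 4)%N; have -> : d = (k.*2.+1 + k.+1.*2)%N by lia.
exists (iter k.+1 mul_1sub4x (eulerian_gamma k.*2.+1)); split.
- by move=> i; apply: mul_1sub4x_iter_bound.
- exact: mul_1sub4x_iter0.
- exact: mul_1sub4x_iter_even.
have -> : (k.*2.+1 + k.+1.*2 = k.*2.+1.*2.+1)%N by lia.
rewrite total_weight_signed_odd total_weight_mpoly.
have [_] := gamma_sum_mul_1sub4x_iter s t k.+1 (@eulerian_gamma_gt k.*2.+1).
have -> : (k.*2.+1 + k.+1.*2 = k.*2.+1.*2.+1)%N by lia.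
by move=> ->.
Qed.

Lemma gamma_sumD d f g :
  gamma_sum s t d f + gamma_sum s t d g = gamma_sum s t d (fun i => f i + g i).
Proof. by rewrite -big_split; apply: eq_bigr => i _; rewrite mulrzDr. Qed.

Lemma gamma_sumB d f g :
  gamma_sum s t d f - gamma_sum s t d g = gamma_sum s t d (fun i => f i - g i).
Proof. by rewrite -sumrB; apply: eq_bigr => i _; rewrite mulrzBr. Qed.

Lemma gamma_positive_Aplus_Aminus d : d = 0 %[mod 4] \/ d = 3 %[mod 4] ->
  gamma_positive d (Aplus R d.+1) /\ gamma_positive d (Aminus R d.+1).
Proof.
move=> /signed_gamma[f [f_le f0 f_even fE]].
have sumE := Aplus_plus_Aminus d; have diffE := Aplus_minus_Aminus d.
have g_even := eulerian_gamma_even d.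
rewrite total_weight_mpoly in sumE; rewrite fE in diffE.
split;
  [apply: (gamma_positive_double (h := fun i => eulerian_gamma d i + f i))
  |apply: (gamma_positive_double (h := fun i => eulerian_gamma d i - f i))].
- exact: Aplus_homog.
- by rewrite -gamma_sumD -sumE -diffE; ring.
- by move=> i; have := f_le i; lia.
(* Both constant coefficients are 1; their sum 2 is even, as is the difference 0 below. *)
- case=> [|i]; first by exists 1; rewrite eulerian_gamma0 f0.
  have [x ->] := f_even i; have [y ->] := g_even i.
  by exists (y + x); rewrite mulrDr.
- exact: Aminus_homog.
- by rewrite -gamma_sumB -sumE -diffE; ring.
- by move=> i; have := f_le i; lia.
- case=> [|i]; first by exists 0; rewrite eulerian_gamma0 f0.
  have [x ->] := f_even i; have [y ->] := g_even i.
  by exists (y - x); rewrite mulrBr.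
Qed.

(** * Evaluation at points, and the center of symmetry *)

Definition eval_st (a b : R) : 'I_2 -> R := fun i => if i == tidx then b else a.

Lemma eval_stX_s a b : s.@[eval_st a b] = a.
Proof. by rewrite mevalXU /eval_st sidxE tidxE. Qed.

Lemma eval_stX_t a b : t.@[eval_st a b] = b.
Proof. by rewrite mevalXU /eval_st eqxx. Qed.

Lemma gamma_positive_eval_swap d f a b :
  gamma_positive d f -> f.@[eval_st a b] = f.@[eval_st b a].
Proof.
case=> _ [g [_ ->]]; rewrite !raddf_sum; apply: eq_bigr => i _ /=.
rewrite !mevalZ !rmorphM /= !rmorphXn /= !rmorphM !rmorphD /=.
by rewrite !eval_stX_s !eval_stX_t mulrC [a + b]addrC [a * b]mulrC mulrC.
Qed.

Lemma total_weight_eval d a b : (total_weight s t 1 d).@[eval_st a b] =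
  gamma_sum a b d (eulerian_gamma d).
Proof.
by rewrite total_weight_mpoly gamma_sum_rmorph /= eval_stX_s eval_stX_t.
Qed.

Lemma total_weight_signed_eval d a b :
  (total_weight s t (-1) d).@[eval_st a b] =
  (a - b) ^+ (uphalf d) * gamma_sum a b d./2 (eulerian_gamma d./2).
Proof.
have stE k : ((s - t) ^+ k).@[eval_st a b] = (a - b) ^+ k.
  by rewrite rmorphXn rmorphB /= eval_stX_s eval_stX_t.
rewrite -total_weight_eval -stE -rmorphM /=; congr (_.@[_]).
rewrite -{1}(odd_double_half d) uphalf_half; case: (odd d).
  exact: total_weight_signed_odd.
exact: total_weight_signed_even.
Qed.

Lemma Aplus_not_gamma_positive d :
  odd (uphalf d) -> ~ gamma_positive d (Aplus R d.+1).
Proof.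
move=> odd_d /(@gamma_positive_eval_swap _ _ 1 0) Aswap.
have A2 : Aplus R d.+1 *+ 2 = total_weight s t 1 d + total_weight s t (-1) d.
  by rewrite -Aplus_plus_Aminus -Aplus_minus_Aminus; ring.
have ev2 a b : (Aplus R d.+1).@[eval_st a b] *+ 2 =
    gamma_sum a b d (eulerian_gamma d)
    + (a - b) ^+ (uphalf d) * gamma_sum a b d./2 (eulerian_gamma d./2).
  by rewrite -mevalMn A2 mevalD total_weight_eval total_weight_signed_eval.
(* Twice the even part is 1 + 1 at (1,0) but 1 - 1 at (0,1), against the symmetry. *)
have := ev2 1 0; rewrite Aswap ev2 subr0 sub0r expr1n -signr_odd odd_d expr1.
rewrite !(gamma_sum_swap 0 1) !gamma_sum10 !eulerian_gamma0 mul1r mulN1r subrr.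
by move/eqP; rewrite eq_sym -mulr2n pnatr_eq0.
Qed.

(** At (1,1) the factor s - t kills the difference of the two polynomials, while their sum is
    positive. *)
Lemma Aplus_Aminus_neq0 d : (0 < d)%N ->
  Aplus R d.+1 != 0 /\ Aminus R d.+1 != 0.
Proof.
move=> d0.
have e1 : (total_weight s t (-1) d).@[eval_st 1 1] = 0.
  rewrite total_weight_signed_eval subrr expr0n.
  by case: d d0 => //= d _; rewrite mul0r.
have e2 : 0 < (total_weight s t 1 d).@[eval_st 1 1].
  rewrite total_weight_eval; apply: gamma_sum11_gt0.
    exact: eulerian_gamma_ge0.
  exact: eulerian_gamma0.
have eD := congr1 (meval (eval_st 1 1)) (Aplus_plus_Aminus d).
have eB := congr1 (meval (eval_st 1 1)) (Aplus_minus_Aminus d).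
rewrite /= mevalD in eD; rewrite /= mevalB e1 in eB.
by split; apply/eqP => A0; move: e2; rewrite -eD; move: eB;
  rewrite A0 meval0 ?sub0r ?subr0 ?addr0 ?add0r; lra.
Qed.

(** Swapping s and t fixes f and sends an exponent k of t to d - k. Hence the least exponent r is
    matched by the largest, d - r. *)
Lemma gamma_positive_center d (f : {mpoly R[2]}) :
  f != 0 -> gamma_positive d f ->
  center_of_symmetry f (d%:R / 2).
Proof.
move=> f0 [/dhomogP fd [g [_ fE]]].
pose sw : 'S_2 := tperm sidx tidx.
have swX i : msym sw ('X_i : {mpoly R[2]}) = 'X_(sw i).
  by rewrite /msym mmapX mmap1U.
have swf : msym sw f = f.
  rewrite fE raddf_sum; apply: eq_bigr => i _ /=.
  rewrite msymZ rmorphM /= !rmorphXn /= rmorphM rmorphD /= !swX tpermL tpermR.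
  by rewrite mulrC [t + s]addrC [t * s]mulrC mulrC.
have swap m : m \in msupp f -> exists2 m' : 'X_{1..2},
    m' \in msupp f & m' tidx = (d - m tidx)%N.
  move=> mf; exists [multinom m (sw i) | i < 2].
    by rewrite mcoeff_msupp -mcoeff_sym swf -mcoeff_msupp.
  rewrite mnmE tpermR -(fd m mf) /= mdegE big_ord_recr big_ord1 /=.
  by rewrite sidxE tidxE addnK; congr (m _); apply: val_inj.
have led m : m \in msupp f -> (m tidx <= d)%N.
  by move=> mf; rewrite -(fd m mf) /= mdegE (bigD1 tidx) //= leq_addr.
have ex : exists k, has (fun m : 'X_{1..2} => m tidx == k) (msupp f).
  by exists (mlead f tidx); apply/hasP; exists (mlead f); rewrite ?mlead_supp.
case: (ex_minnP ex) => r /hasP[m mf /eqP mr] rmin.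
have rmin' m' : m' \in msupp f -> (r <= m' tidx)%N.
  by move=> m'f; apply: rmin; apply/hasP; exists m'.
exists r, (d - r)%N; split.
- by exists m.
- by have [m' m'f m'E] := swap m mf; exists m'; rewrite // m'E mr.
- move=> m' m'f; rewrite rmin' //=; have [m2 m2f m2E] := swap m' m'f.
  by have := rmin' m2 m2f; have := led m' m'f; rewrite m2E; lia.
- by rewrite subnK // -mr led.
Qed.
End Bivariate.

(* The equivalence and the common center *)
Local Close Scope ring_scope.

Theorem theorem1 (R : realDomainType) (n : nat) (n_ge1 : 1 <= n) :
  ((gamma_positive (n - 1) (Aplus R n) /\ gamma_positive (n - 1) (Aminus R n))
    <-> (n = 0 %[mod 4] \/ n = 1 %[mod 4]))
  /\
  (n = 0 %[mod 4] \/ n = 1 %[mod 4] -> 1 < n ->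
    exists c : rat,
      center_of_symmetry (Aplus R n) c /\ center_of_symmetry (Aminus R n) c).
Proof.
case: n n_ge1 => // d _; rewrite subn1 /=.
have d4 : d.+1 = 0 %[mod 4] \/ d.+1 = 1 %[mod 4] ->
    d = 0 %[mod 4] \/ d = 3 %[mod 4] by lia.
split; [split=> [[Ap _]|/d4 /gamma_positive_Aplus_Aminus //]
       | move=> /d4 dmod d_gt0].
  (* [uphalf d] is floor (n/2), which is even exactly when n is 0 or 1 modulo 4. *)
  case: (boolP (odd (uphalf d))) => [/Aplus_not_gamma_positive/(_ Ap) //|].
  lia.
have [Ap Am] := gamma_positive_Aplus_Aminus R dmod.
(* Here n > 1 matters: for n = 1 the odd part is 0 and has no center. *)
have [Ap0 Am0] := Aplus_Aminus_neq0 R d_gt0.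
by exists (d%:R / 2)%R; split; apply: gamma_positive_center.
Qed.
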